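(* The relation algebra $7_7$ is representable over $\mathbb{Z}/n\mathbb{Z}$ for every $n\geq 12$, and $\mathrm{CySp}(7_7)=\{n : n\geq 12\}$.
   Context: $7_7$ is the finite symmetric integral relation algebra with three atoms $1'$ (identity), $a$, $b$ (all symmetric, i.e. self-converse) in which all the diversity cycles $aaa$, $bbb$, $abb$, $baa$ are mandatory. Equivalently its composition is $a;a=1'+a+b$, $b;b=1'+a+b$, $a;b=b;a=a+b$. For a positive integer $n$, a representation of $7_7$ over the cyclic group $\mathbb{Z}/n\mathbb{Z}$ is a partition of $\mathbb{Z}/n\mathbb{Z}$ into $\mathrm{Id}=\{0\}$ and two nonempty sets $A,B$ with $A=-A$, $B=-B$, such that $A+A=A\cup B\cup\mathrm{Id}$, $B+B=A\cup B\cup\mathrm{Id}$, and $A+B=A\cup B$, where $X+Y=\{x+y : x\in X,\ y\in Y\}$ (addition modulo $n$). The algebra is representable over $\mathbb{Z}/n\mathbb{Z}$ if such a partition exists. The cyclic spectrum is $\mathrm{CySp}(7_7)=\{n : n \text{ a positive integer and } 7_7 \text{ is representable over } \mathbb{Z}/n\mathbb{Z}\}$. *)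

(* Defs.v *)
From mathcomp Require Import all_boot all_algebra.

Set Implicit Arguments.
Unset Strict Implicit.
Unset Printing Implicit Defensive.

Import GRing.Theory.
Local Open Scope ring_scope.

Definition sumset (G : finZmodType) (X Y : {set G}) : {set G} :=
  [set x + y | x in X, y in Y].

Definition oppset (G : finZmodType) (X : {set G}) : {set G} :=
  [set - x | x in X].

(* Pairwise disjointness of the three classes is spelled out: with
   [partition], the set of classes [set [set 0]; A; B] would collapse if A
   and B coincided. *)
Definition is_partition3 (G : finZmodType) (A B : {set G}) : bool :=
  [&& A != set0, B != set0,
      [disjoint [set 0] & A], [disjoint [set 0] & B], [disjoint A & B]
    & [set 0] :|: A :|: B == [set: G]].

Definition is_rep77 (G : finZmodType) (A B : {set G}) : bool :=
  [&& is_partition3 A B,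
      A == oppset A, B == oppset B,
      sumset A A == A :|: B :|: [set 0],
      sumset B B == A :|: B :|: [set 0]
    & sumset A B == A :|: B].

(* For n > 0 this is Z/nZ: 'I_m.+1 carries the additive group of the integers
   modulo m.+1, whereas 'Z_n is not Z/nZ for n = 1.  At n = 0 it is the
   trivial group, a case excluded from CySp77 below. *)
Definition cyclic_group (n : nat) : finZmodType := 'I_n.-1.+1.

Definition representable77 (n : nat) : bool :=
  [exists A : {set cyclic_group n}, exists B : {set cyclic_group n},
     is_rep77 A B].

Definition CySp77 : pred nat := [pred n | (0 < n)%N && representable77 n].

(* Main.v *)
Require Import Defs.
From mathcomp Require Import all_boot all_algebra.
From mathcomp Require Import zify.

(** Let [|x|] be the distance from [x] to [0] in Z/nZ and [m = n %/ 4 + 1]. For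
    [n >= 13] take [A = {x : |x| = 1 or 3 <= |x| <= m}] and let [B] be the set
    of the other nonzero elements, so that [B] is [{2, -2}] together with the
    interval [m+1, n-m-1]. By symmetry only targets [0 <= x <= n/2] matter, and
    each of them is an explicit sum or difference of two elements of the
    required classes, without any wrap-around modulo [n]. The orders [n <= 12]
    are settled by evaluation. *)

Set Implicit Arguments.
Unset Strict Implicit.
Unset Printing Implicit Defensive.

Import GRing.Theory.

(** * Representations over a finite abelian group *)

Section Classes.

Variable G : finZmodType.
Implicit Types (A B : {set G}) (x y : G).

Local Open Scope ring_scope.

Lemma in_sumset A B x :
  reflect (exists2 y, y \in A & x - y \in B) (x \in sumset A B).
Proof.
apply: (iffP imset2P) => [[y z Ay Bz ->]|[y Ay Bxy]].
  by exists y; rewrite // [y + z]addrC addrK.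
by exists y (x - y); rewrite // addrC subrK.
Qed.

Arguments in_sumset {A B x}.

Lemma in_oppset A x : (x \in oppset A) = (- x \in A).
Proof.
apply/imsetP/idP => [[y Ay ->]|Ax]; first by rewrite opprK.
by exists (- x); rewrite ?opprK.
Qed.

(** A representation is thus determined by its class [A], so a search may range over single
    subsets. *)
Lemma is_partition3_compl A B :
  is_partition3 A B -> 0 \notin A /\ B = ~: (0 |: A).
Proof.
case/and5P=> _ _ A'0 B'0 /andP[AB /eqP/setP cover].
split; first by rewrite disjoints1 in A'0.
apply/setP=> x; have:= cover x; rewrite !inE.
rewrite disjoints1 in B'0.
have [-> _|_] := eqVneq x 0; first exact: negPf.
by have [/(disjointFr AB)->|] := boolP (x \in A).
Qed.

(** Only covering conditions and the symmetry of [A] remain: a class is nonempty because 0 is a sum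
    of two of its elements, and 0 stays out of [A + B] because [- y] lies in [A] whenever [y]
    does. *)
Lemma is_rep77P A :
  0 \notin A ->
  reflect [/\ forall x, (- x \in A) = (x \in A),
              sumset A A = setT, sumset (~: (0 |: A)) (~: (0 |: A)) = setT
            & forall x, x != 0 -> x \in sumset A (~: (0 |: A))]
          (is_rep77 A (~: (0 |: A))).
Proof.
set B := ~: _ => A'0.
have cover : A :|: B :|: [set 0] = setT.
  by apply/setP=> x; rewrite !inE; case: (x == 0); case: (x \in A).
have coverE : A :|: B = [set~ 0].
  apply/setP=> x; rewrite !inE.
  by have [->|_] := eqVneq x 0; [rewrite (negPf A'0) | case: (x \in A)].
apply: (iffP idP).
  case/and5P=> _ /eqP/setP symA _ /eqP AA /andP[/eqP BB /eqP AB].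
  split=> [x|||x x0]; rewrite ?AA ?BB //.
    by rewrite [RHS]symA in_oppset.
  by rewrite AB coverE !inE.
case=> symA AA BB AB.
have nonempty (X : {set G}) : sumset X X = setT -> X != set0.
  move=> XX; have /in_sumset[x Xx _] : 0 \in sumset X X by rewrite XX inE.
  by apply/set0Pn; exists x.
apply/and5P; split.
- rewrite /is_partition3 !nonempty // !disjoints1 A'0 !inE eqxx /=.
  by rewrite disjoints_subset setCK subsetUr -setUA setUC cover eqxx.
- by apply/eqP/setP=> x; rewrite in_oppset symA.
- by apply/eqP/setP=> x; rewrite in_oppset !inE symA oppr_eq0.
- by rewrite AA cover.
rewrite BB cover eqxx coverE; apply/eqP/setP=> x; rewrite !inE.
have [->|/AB//] := eqVneq x 0.
by apply/negP=> /in_sumset[y Ay]; rewrite sub0r !inE symA Ay orbT.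
Qed.

End Classes.

(** * Reformulation on natural numbers *)

Definition covers (n : nat) (p q : pred nat) : pred nat :=
  fun x => has (fun i => p i && q ((x + (n - i) %% n) %% n)) (iota 0 n).

Definition rest (p : pred nat) : pred nat := fun i => (0 < i) && ~~ p i.

Definition nat_rep77 (n : nat) (p : pred nat) : bool :=
  ~~ p 0 &&
  all (fun x => [&& p ((n - x) %% n) == p x, covers n p p x,
                    covers n (rest p) (rest p) x
                  & (x == 0) || covers n p (rest p) x]) (iota 0 n).

(** The two reductions modulo [n] in [covers] copy the opposite and the addition of ['I_m.+1], so
    the value of [x - y] matches by conversion. *)
Lemma in_sumset_ord (m : nat) (p q : pred nat) (A B : {set 'I_m.+1})
    (x : 'I_m.+1) :
  (forall i : 'I_m.+1, (i \in A) = p i) ->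
  (forall i : 'I_m.+1, (i \in B) = q i) ->
  (x \in sumset A B) = covers m.+1 p q x.
Proof.
move=> Ap Bq; apply/in_sumset/hasP => [[y Ay Bxy]|[i]].
  exists (val y); first by rewrite mem_iota ltn_ord.
  by rewrite -Ap Ay; rewrite Bq in Bxy.
rewrite mem_iota => /= lt_i /andP[pi qxi].
by exists (Ordinal lt_i); rewrite ?Ap ?Bq.
Qed.

Arguments in_sumset_ord {m p q A B x}.

(** The resulting test can be evaluated in small orders and handled by linear arithmetic in
    general. *)
Lemma nat_rep77E (m : nat) (p : pred nat) (A : {set 'I_m.+1}) :
  (forall i : 'I_m.+1, (i \in A) = p i) ->
  (0%R \notin A) && is_rep77 A (~: (0%R |: A)) = nat_rep77 m.+1 p.
Proof.
move=> Ap; rewrite /nat_rep77 [in LHS]Ap.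
have [//|p0] := boolP (p 0); rewrite !andTb.
have A'0 : 0%R \notin A by rewrite Ap.
have Bp (i : 'I_m.+1) : (i \in ~: (0%R |: A)) = rest p i.
  by rewrite !inE negb_or Ap -val_eqE /rest lt0n.
apply/(is_rep77P A'0)/allP.
  case=> symA AA BB AB x; rewrite mem_iota => /= lt_x0.
  have {lt_x0}lt_x : x < m.+1 by [].
  have xE : x = val (Ordinal lt_x) by [].
  rewrite {}xE; move: (Ordinal lt_x) => {lt_x}x.
  rewrite -(in_sumset_ord Ap Ap) -(in_sumset_ord Bp Bp).
  rewrite -(in_sumset_ord Ap Bp) AA BB !in_setT -Ap -symA Ap eqxx !andTb.
  by have [->//|/AB->] := eqVneq x 0%R; rewrite orbT.
move=> cov.
have {}cov (x : 'I_m.+1) := cov (val x) (etrans (mem_iota 0 _ _) (ltn_ord x)).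
split=> [x|||x x0].
- by rewrite !Ap; have /and4P[/eqP] := cov x.
- by apply/setP=> x; rewrite inE (in_sumset_ord Ap Ap); have /and4P[] := cov x.
- by apply/setP=> x; rewrite inE (in_sumset_ord Bp Bp); have /and4P[] := cov x.
- rewrite (in_sumset_ord Ap Bp); have /and4P[_ _ _ /orP[/eqP x_0|//]] := cov x.
  by case/eqP: x0; apply: val_inj.
Qed.

Lemma representable77_nat (n : nat) (p : pred nat) :
  0 < n -> nat_rep77 n p -> representable77 n.
Proof.
case: n => // m _ rep_p; pose A : {set 'I_m.+1} := [set i : 'I_m.+1 | p i].
apply/existsP; exists A; apply/existsP; exists (~: (0%R |: A)).
rewrite -(nat_rep77E (A := A)) in rep_p; last by move=> i; rewrite inE.
by case/andP: rep_p.
Qed.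

(** * Exhaustive search below order 12 *)

Lemma representable77_bitseq (n : nat) :
  0 < n -> representable77 n ->
  exists2 s : seq bool, size s = n & nat_rep77 n (nth false s).
Proof.
case: n => // m _ /existsP[A /existsP[B AB]].
have /is_partition3_compl[A'0 defB] : is_partition3 A B by case/andP: AB.
exists [seq inord i \in A | i <- iota 0 m.+1].
  by rewrite size_map size_iota.
rewrite -(nat_rep77E (A := A)) ?A'0 -?defB // => i.
by rewrite (nth_map 0) ?size_iota // nth_iota // inord_val.
Qed.

(** The bits chosen so far are absorbed into [P], so the list of all sequences is never built. *)
Fixpoint all_bitseqs (n : nat) (P : pred (seq bool)) : bool :=
  if n is n'.+1 then
    all_bitseqs n' (fun s => P (true :: s)) &&
    all_bitseqs n' (fun s => P (false :: s))
  else P [::].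

Lemma all_bitseqsP (P : pred (seq bool)) (s : seq bool) :
  all_bitseqs (size s) P -> P s.
Proof.
elim: s P => //= -[] s IHs P /andP[Pt Pf]; first exact: (IHs _ Pt).
exact: (IHs _ Pf).
Qed.

Lemma not_representable77 (n : nat) : 0 < n < 12 -> ~~ representable77 n.
Proof.
case/andP=> n_gt0 n_lt12; apply/negP=> /(representable77_bitseq n_gt0)[s sz_s].
apply/negP; move: s sz_s.
(* All [2 ^ k] candidates for [A] are refuted for each [k] from 1 to 11, 4094 in total. *)
have : all (fun k => all_bitseqs k (fun s => ~~ nat_rep77 k (nth false s)))
           (iota 1 11).
  by vm_compute.
move/allP/(_ n); rewrite mem_iota n_gt0 => /(_ n_lt12) all_n s sz_s.
by rewrite -sz_s in all_n *; apply: (all_bitseqsP all_n).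
Qed.

(** * Sums and differences of distances *)

Lemma covers_sum (n : nat) (p q : pred nat) (i j x : nat) :
  0 < i < n -> j < n -> p i -> q j -> i + j = x \/ i + j = x + n ->
  covers n p q x.
Proof.
move=> i_n lt_j pi qj ijx; apply/hasP; exists i; first by rewrite mem_iota; lia.
rewrite pi modnDmr; suff -> : (x + (n - i)) %% n = j by [].
have [->|->] : x + (n - i) = j + n \/ x + (n - i) = j by lia.
  by rewrite modnDr modn_small.
by rewrite modn_small.
Qed.

Definition sym_pred (n : nat) (p : pred nat) : Prop :=
  forall i, 0 < i < n -> p (n - i) = p i.

(** Symmetry leaves the signs of the summands free: [x] may be [a + b], [a - b] or [b - a], with
    [n - a] and [n - b] serving as opposites. *)
Lemma covers_dist (n : nat) (p q : pred nat) (a b x : nat) :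
  sym_pred n p -> sym_pred n q -> 0 < a < n -> 0 < b < n -> p a -> q b ->
  x = a + b \/ a = b + x \/ b = a + x -> covers n p q x.
Proof.
move=> symp symq a_n b_n pa qb.
have pa' : p (n - a) by rewrite symp.
have qb' : q (n - b) by rewrite symq.
case=> [abx|[abx|abx]].
- by apply: (covers_sum (i := a) (j := b)) => //; lia.
- by apply: (covers_sum (i := a) (j := n - b)) => //; lia.
- by apply: (covers_sum (i := n - a) (j := b)) => //; lia.
Qed.

(** Both summands of [n - x] are negated. They are nonzero since [p] and [q] fail at 0, so [n - i]
    and [n - j] are again residues below [n]. *)
Lemma covers_opp (n : nat) (p q : pred nat) (x : nat) :
  sym_pred n p -> sym_pred n q -> ~~ p 0 -> ~~ q 0 -> 0 < x < n ->
  covers n p q (n - x) -> covers n p q x.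
Proof.
move=> symp symq p0 q0 x_n /hasP[i]; rewrite mem_iota => i_n /andP[pi qj].
have i_gt0 : 0 < i by case: (posnP i) pi p0 => // -> ->.
set j := (_ %% n) in qj.
have j_gt0 : 0 < j by case: (posnP j) qj q0 => // -> ->.
have lt_j : j < n by rewrite ltn_mod; lia.
have ijx : i + j = n - x \/ i + j = n - x + n.
  rewrite /j (modn_small (m := n - i)); last lia.
  have [le_in|lt_ni] := leqP i (n - x).
    left; have -> : n - x + (n - i) = n - x - i + n by lia.
    by rewrite modnDr modn_small; lia.
  by right; rewrite modn_small; lia.
apply: (covers_sum (i := n - i) (j := n - j)); rewrite ?symp ?symq; lia.
Qed.

(** * The interval construction *)

Definition interval_pred (n : nat) : pred nat := fun i =>
  (minn i (n - i) == 1) || (3 <= minn i (n - i) <= (n %/ 4).+1).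

Lemma nat_rep77_interval (n : nat) : 13 <= n -> nat_rep77 n (interval_pred n).
Proof.
move=> n13; pose p := interval_pred n; rewrite -/p.
(* These linear bounds determine [m = n %/ 4 + 1] without division; [4 <= m] puts the distances 3, 4
   and [m - 1] in [A]. *)
have [m [m_le m_gt m4]] : exists m, [/\ 4 * m <= n + 4, n < 4 * m & 4 <= m].
  by exists (n %/ 4).+1; split; lia.
have pE i : p i = (minn i (n - i) == 1) || (3 <= minn i (n - i) <= m).
  by rewrite /p /interval_pred; have -> : (n %/ 4).+1 = m by lia.
have qE i : rest p i =
    (0 < i) && ~~ ((minn i (n - i) == 1) || (3 <= minn i (n - i) <= m)).
  by rewrite /rest pE.
have p0 : ~~ p 0 by rewrite pE; lia.
have q0 : ~~ rest p 0 by [].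
have symp : sym_pred n p by move=> i i_n; rewrite !pE; lia.
have symq : sym_pred n (rest p) by move=> i i_n; rewrite !qE; lia.
rewrite /nat_rep77 p0; apply/allP=> x; rewrite mem_iota add0n => x_n.
(* The lower bound [k] is 0 for [A + A] and [B + B], and 1 for [A + B], where the target 0 is
   excluded. *)
have half (r s : pred nat) k :
    sym_pred n r -> sym_pred n s -> ~~ r 0 -> ~~ s 0 ->
    (forall y, k <= y -> 2 * y <= n -> covers n r s y) ->
    k <= x -> k <= n - x -> covers n r s x.
  move=> symr syms r0 s0 cov kx knx.
  have [le_x|gt_x] := leqP (2 * x) n; first exact: cov.
  by apply: covers_opp => //; [lia | apply: cov; lia].
have dist (r t : pred nat) a b y := @covers_dist n r t a b y.
apply/and4P; split.
- have [->|x0] := posnP x; first by rewrite subn0 modnn.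
  by rewrite modn_small ?symp //; lia.
- apply: (half _ _ 0) => // y _ le_y.
  have pp a b := dist p p a b y symp symp.
  have [y_gt|y_le] := ltnP m.+1 y.
    (* Here [m + (y - m)] would use the distance 2, which belongs to [B]. *)
    have [->|y_m] := eqVneq y (m + 2).
      by apply: (dist _ _ (m - 1) 3); rewrite ?pE //; lia.
    by apply: (pp m (y - m)); rewrite ?pE; lia.
  have [y_ge4|] := leqP 4 y; first by apply: (pp 1 (y - 1)); rewrite ?pE; lia.
  case: y le_y pp y_le => [|[|[|[|//]]]] _ pp _ _.
  + by apply: (pp 1 1); rewrite ?pE; lia.
  + by apply: (pp 3 4); rewrite ?pE; lia.
  + by apply: (pp 1 1); rewrite ?pE; lia.
  + by apply: (pp 1 4); rewrite ?pE; lia.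
- apply: (half _ _ 0) => // y _ le_y.
  have qq a b := dist _ _ a b y symq symq.
  have [y_le|y_gt] := leqP (y + 2) m.
    by apply: (qq (m + 1) (m + 1 + y)); rewrite ?qE; lia.
  (* Membership of [y + 2] in [B] needs [y + 2 <= n - m - 1], which would fail for [n = 12] and
     [y = 6]. *)
  by apply: (qq 2 (y + 2)); rewrite ?qE; lia.
- have [->//|x0] := eqVneq x 0.
  apply: (half _ _ 1) => //; [move=> y y_gt0 le_y | lia | lia].
  have pq a b := dist _ _ a b y symp symq.
  have [y_gt|y_le] := ltnP m.+1 y.
    by apply: (pq 1 (y - 1)); rewrite ?pE ?qE; lia.
  have [->|y_1] := eqVneq y 1.
    by apply: (dist _ _ 3 2); rewrite ?pE ?qE //; lia.
  have [->|y_2] := eqVneq y 2.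
    by apply: (dist _ _ (m - 1) (m + 1)); rewrite ?pE ?qE //; lia.
  (* The difference [(m + 1) - (m + 1 - y)] used at the end breaks down at [y = m + 1] and
     [y = m - 1], where the distance required from [A] would be 0 or 2. *)
  have [->|y_m1] := eqVneq y (m + 1).
    by apply: (dist _ _ (m - 1) 2); rewrite ?pE ?qE //; lia.
  have [->|y_m] := eqVneq y m.
    by apply: (dist _ _ 1 (m + 1)); rewrite ?pE ?qE //; lia.
  have [->|y_mp] := eqVneq y (m - 1).
    by apply: (dist _ _ 3 (m + 2)); rewrite ?pE ?qE //; lia.
  by apply: (pq (m + 1 - y) (m + 1)); rewrite ?pE ?qE; lia.
Qed.

Lemma representable77_ge12 (n : nat) : 12 <= n -> representable77 n.
Proof.
rewrite leq_eqVlt => /predU1P[<-|n13].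
  (* Order 12 takes [A] as the elements at distance 1, 2 or 5, because the interval choice would
     leave 6 outside [B + B]. *)
  exact: (@representable77_nat _ [pred i | i \in [:: 1; 2; 5; 7; 10; 11]]).
by apply: representable77_nat (nat_rep77_interval n13); lia.
Qed.

Theorem theorem11 :
  (forall n : nat, 12 <= n -> representable77 n) /\
  CySp77 =i [pred n : nat | 12 <= n].
Proof.
split=> [|n]; first exact: representable77_ge12.
rewrite !inE; have [n12|n12] := leqP 12 n.
  by rewrite representable77_ge12 // andbT; lia.
have [->//|n_gt0] := posnP n.
by apply/negbTE/not_representable77; rewrite n_gt0.
Qed.
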